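(* (Noether's third isomorphism theorem.) In a prohomological category with initial object $0$, let $H\equiv(H,e,h)$ and $H'\equiv(H',e',h')$ be two normal spans over an object $X$, and let $\eta\colon H\to H'$ be a morphism of normal spans between them, so that $H\le H'$. Then: 1. $H$ is a normal span over $H'$ (via $e\colon H\to 0$ and $\eta\colon H\to H'$); 2. $H'/H$ is a normal span over $X/H$ (via the canonically induced morphisms $H'/H\to0$ and $H'/H\to X/H$); 3. there is an isomorphism $(X/H)/(H'/H)\cong X/H'$.
   Context: A finitely complete category is propointed if it admits an initial object $0$ and the unique morphism $0\to1$ is a universal extremal epimorphism (an extremal epimorphism all of whose pullbacks are extremal epimorphisms). A prohomological category is a propointed regular category that is protomodular in the sense of Bourn (for every morphism $v\colon Y\to X$ the pullback functor from the category of split epimorphisms with chosen section over $X$ to that over $Y$ is conservative). In a category with an initial object $0$, the kernel of $f\colon X\to Y$ is the span $(H,e\colon H\to0,h\colon H\to X)$ given by the pullback of $f$ along the unique morphism $0\to Y$. A normal span over $X$ is a span $(H,e\colon H\to 0,h\colon H\to X)$ that is the kernel of some morphism with domain $X$. A morphism $(H,e,h)\to(H',e',h')$ of normal spans over $X$ is a morphism $\eta\colon H\to H'$ with $e'\circ\eta=e$ and $h'\circ\eta=h$; if one exists it is unique and one writes $H\le H'$. In a prohomological category, for every normal span $(H,e,h)$ over $X$ the pushout of $e$ along $h$ exists and $(H,e,h)$ is the kernel of the resulting morphism $p\colon X\to X/H$; here $X/H=X/(H,e,h)$ denotes this pushout. The morphism $H'/H\to0$ is the one induced on the pushout of $e$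 along $\eta$ by $e'\colon H'\to 0$ and $\mathrm{id}_0$; the morphism $H'/H\to X/H$ is the one induced by $p\circ h'\colon H'\to X/H$ and the unique morphism $0\to X/H$. *)

(* Defs.v *)
From Stdlib Require Import List IndefiniteDescription ProofIrrelevance.

Set Implicit Arguments.
Unset Strict Implicit.
Unset Printing Implicit Defensive.

Record Category : Type := {
  ob :> Type;
  hom : ob -> ob -> Type;
  idm : forall A, hom A A;
  comp : forall A B D, hom B D -> hom A B -> hom A D;
  comp_idl : forall A B (f : hom A B), comp (idm B) f = f;
  comp_idr : forall A B (f : hom A B), comp f (idm A) = f;
  comp_assoc : forall A B D E (h : hom D E) (g : hom B D) (f : hom A B),
    comp h (comp g f) = comp (comp h g) f
}.

Arguments idm {c} A.

Declare Scope cat_scope.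
Delimit Scope cat_scope with cat.
Open Scope cat_scope.
Notation "A ~> B" := (hom A B) (at level 70, no associativity) : cat_scope.
Notation "g ∘ f" := (comp g f) (at level 40, left associativity) : cat_scope.

Record Functor (J C : Category) : Type := {
  fob :> J -> C;
  fmap : forall i j : J, i ~> j -> fob i ~> fob j;
  fmap_id : forall i : J, fmap (idm i) = idm (fob i);
  fmap_comp : forall (i j k : J) (g : j ~> k) (f : i ~> j),
    fmap (g ∘ f) = fmap g ∘ fmap f
}.

Section Notions.
Variable C : Category.

Definition is_iso (A B : C) (f : A ~> B) : Prop :=
  exists g : B ~> A, g ∘ f = idm A /\ f ∘ g = idm B.

Definition isomorphic (A B : C) : Prop := exists f : A ~> B, is_iso f.

Definition is_mono (A B : C) (m : A ~> B) : Prop :=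
  forall (Z : C) (u v : Z ~> A), m ∘ u = m ∘ v -> u = v.

Definition is_epi (A B : C) (q : A ~> B) : Prop :=
  forall (Z : C) (u v : B ~> Z), u ∘ q = v ∘ q -> u = v.

Record InitialObject : Type := {
  init_ob :> C;
  init_map : forall X : C, init_ob ~> X;
  init_unique : forall (X : C) (f : init_ob ~> X), f = init_map X
}.

Record TerminalObject : Type := {
  term_ob :> C;
  term_map : forall X : C, X ~> term_ob;
  term_unique : forall (X : C) (f : X ~> term_ob), f = term_map X
}.

Definition is_cone (J : Category) (D : Functor J C) (L : C)
    (pi : forall j : J, L ~> D j) : Prop :=
  forall (i j : J) (a : i ~> j), fmap D a ∘ pi i = pi j.

Definition is_limit (J : Category) (D : Functor J C) (L : C)
    (pi : forall j : J, L ~> D j) : Prop :=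
  is_cone pi /\
  forall (Z : C) (s : forall j : J, Z ~> D j), is_cone s ->
    exists! u : Z ~> L, forall j : J, pi j ∘ u = s j.

(* f : A ~> D and g : B ~> D form the cospan, p : P ~> A and q : P ~> B the
   projections; q is the pullback of f along g. *)
Definition is_pullback (A B D P : C) (f : A ~> D) (g : B ~> D)
    (p : P ~> A) (q : P ~> B) : Prop :=
  f ∘ p = g ∘ q /\
  forall (Z : C) (u : Z ~> A) (v : Z ~> B), f ∘ u = g ∘ v ->
    exists! w : Z ~> P, p ∘ w = u /\ q ∘ w = v.

Record Pullback (A B D : C) (f : A ~> D) (g : B ~> D) : Type := {
  pb_ob :> C;
  pb_fst : pb_ob ~> A;
  pb_snd : pb_ob ~> B;
  pb_is_pullback : is_pullback f g pb_fst pb_snd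
}.

Definition is_pushout (A B D Q : C) (f : D ~> A) (g : D ~> B)
    (i : A ~> Q) (j : B ~> Q) : Prop :=
  i ∘ f = j ∘ g /\
  forall (Z : C) (u : A ~> Z) (v : B ~> Z), u ∘ f = v ∘ g ->
    exists! w : Q ~> Z, w ∘ i = u /\ w ∘ j = v.

Record Pushout (A B D : C) (f : D ~> A) (g : D ~> B) : Type := {
  po_ob :> C;
  po_inl : A ~> po_ob;
  po_inr : B ~> po_ob;
  po_is_pushout : is_pushout f g po_inl po_inr
}.

Definition is_coequalizer (A B Q : C) (f g : A ~> B) (q : B ~> Q) : Prop :=
  q ∘ f = q ∘ g /\
  forall (Z : C) (u : B ~> Z), u ∘ f = u ∘ g -> exists! w : Q ~> Z, w ∘ q = u.

Definition is_regular_epi (B Q : C) (q : B ~> Q) : Prop :=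
  exists (A : C) (f g : A ~> B), is_coequalizer f g q.

Definition is_extremal_epi (A B : C) (q : A ~> B) : Prop :=
  is_epi q /\
  forall (M : C) (g : A ~> M) (m : M ~> B), is_mono m -> q = m ∘ g -> is_iso m.

Definition is_universal_extremal_epi (A B : C) (q : A ~> B) : Prop :=
  is_extremal_epi q /\
  forall (Y P : C) (v : Y ~> B) (a : P ~> A) (q' : P ~> Y),
    is_pullback q v a q' -> is_extremal_epi q'.

Lemma pullback_map_sig (A B D : C) (f : A ~> D) (g : B ~> D)
    (P : Pullback f g) (Z : C) (u : Z ~> A) (v : Z ~> B) :
  f ∘ u = g ∘ v -> {w : Z ~> P | pb_fst P ∘ w = u /\ pb_snd P ∘ w = v}.
Proof.
intros E; apply constructive_indefinite_description.
destruct (proj2 (pb_is_pullback P) Z u v E) as [w [Hw _]]; exists w; exact Hw.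
Qed.

Definition pullback_map (A B D : C) (f : A ~> D) (g : B ~> D)
    (P : Pullback f g) (Z : C) (u : Z ~> A) (v : Z ~> B)
    (E : f ∘ u = g ∘ v) : Z ~> P :=
  proj1_sig (pullback_map_sig P E).

Lemma pullback_map_fst (A B D : C) (f : A ~> D) (g : B ~> D)
    (P : Pullback f g) (Z : C) (u : Z ~> A) (v : Z ~> B) (E : f ∘ u = g ∘ v) :
  pb_fst P ∘ pullback_map P E = u.
Proof. exact (proj1 (proj2_sig (pullback_map_sig P E))). Qed.

Lemma pullback_map_snd (A B D : C) (f : A ~> D) (g : B ~> D)
    (P : Pullback f g) (Z : C) (u : Z ~> A) (v : Z ~> B) (E : f ∘ u = g ∘ v) :
  pb_snd P ∘ pullback_map P E = v.
Proof. exact (proj2 (proj2_sig (pullback_map_sig P E))). Qed.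

Lemma pullback_hom_ext (A B D : C) (f : A ~> D) (g : B ~> D)
    (P : Pullback f g) (Z : C) (w w' : Z ~> P) :
  pb_fst P ∘ w = pb_fst P ∘ w' -> pb_snd P ∘ w = pb_snd P ∘ w' -> w = w'.
Proof.
intros E1 E2; destruct (pb_is_pullback P) as [E U].
assert (E' : f ∘ (pb_fst P ∘ w') = g ∘ (pb_snd P ∘ w'))
  by now rewrite !comp_assoc, E.
destruct (U _ _ _ E') as [x [_ Hx]].
rewrite <- (Hx w (conj E1 E2)); apply Hx; split; reflexivity.
Qed.

Lemma pushout_map_sig (A B D : C) (f : D ~> A) (g : D ~> B)
    (Q : Pushout f g) (Z : C) (u : A ~> Z) (v : B ~> Z) :
  u ∘ f = v ∘ g -> {w : Q ~> Z | w ∘ po_inl Q = u /\ w ∘ po_inr Q = v}.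
Proof.
intros E; apply constructive_indefinite_description.
destruct (proj2 (po_is_pushout Q) Z u v E) as [w [Hw _]]; exists w; exact Hw.
Qed.

Definition pushout_map (A B D : C) (f : D ~> A) (g : D ~> B)
    (Q : Pushout f g) (Z : C) (u : A ~> Z) (v : B ~> Z)
    (E : u ∘ f = v ∘ g) : Q ~> Z :=
  proj1_sig (pushout_map_sig Q E).

Lemma pushout_map_inl (A B D : C) (f : D ~> A) (g : D ~> B)
    (Q : Pushout f g) (Z : C) (u : A ~> Z) (v : B ~> Z) (E : u ∘ f = v ∘ g) :
  pushout_map Q E ∘ po_inl Q = u.
Proof. exact (proj1 (proj2_sig (pushout_map_sig Q E))). Qed.

Lemma pushout_map_inr (A B D : C) (f : D ~> A) (g : D ~> B)
    (Q : Pushout f g) (Z : C) (u : A ~> Z) (v : B ~> Z) (E : u ∘ f = v ∘ g) :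
  pushout_map Q E ∘ po_inr Q = v.
Proof. exact (proj2 (proj2_sig (pushout_map_sig Q E))). Qed.

End Notions.

Definition finite_type (T : Type) : Prop := exists s : list T, forall x, In x s.

Definition finite_category (J : Category) : Prop :=
  finite_type J /\ forall i j : J, finite_type (i ~> j).

Definition finitely_complete (C : Category) : Prop :=
  forall J : Category, finite_category J -> forall D : Functor J C,
    exists (L : C) (pi : forall j : J, L ~> D j), is_limit pi.

(* The shape * -> * <- *, used to extract pullbacks from finite limits. *)
Inductive cospan_ob : Set := cospan_l | cospan_r | cospan_m.

Definition cospan_hom (a b : cospan_ob) : Set :=
  match a, b with
  | cospan_l, cospan_r | cospan_r, cospan_l
  | cospan_m, cospan_l | cospan_m, cospan_r => Empty_set
  | _, _ => unit
  end.

Definition cospan_id (a : cospan_ob) : cospan_hom a a :=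
  match a with cospan_l => tt | cospan_r => tt | cospan_m => tt end.

Definition cospan_comp (a b d : cospan_ob) :
  cospan_hom b d -> cospan_hom a b -> cospan_hom a d.
Proof. destruct a, b, d; simpl; intros x y; solve [destruct x | destruct y | exact tt]. Defined.

Definition cospan_category : Category.
Proof.
refine {| ob := cospan_ob; hom := cospan_hom; idm := cospan_id;
          comp := cospan_comp |}.
- intros [] [] []; reflexivity.
- intros [] [] []; reflexivity.
- intros [] [] [] [] [] [] []; reflexivity.
Defined.

Lemma cospan_finite : finite_category cospan_category.
Proof.
split.
- exists (cospan_l :: cospan_r :: cospan_m :: nil); intros []; simpl; auto.
- intros [] []; first [exists (tt :: nil); intros []; simpl; auto; fail
                      | exists nil; intros []].
Qed.

Section CospanDiagram.
Variables (C : Category) (A B D : C) (f : A ~> D) (g : B ~> D).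

Definition cospan_fob (a : cospan_ob) : C :=
  match a with cospan_l => A | cospan_r => B | cospan_m => D end.

Definition cospan_fmap (a b : cospan_ob) :
  cospan_hom a b -> cospan_fob a ~> cospan_fob b.
Proof.
destruct a, b; simpl; intros x;
  solve [destruct x | exact (idm _) | exact f | exact g].
Defined.

Definition cospan_functor : Functor cospan_category C.
Proof.
refine {| fob := cospan_fob : cospan_category -> C; fmap := cospan_fmap |}.
- intros []; reflexivity.
- intros [] [] [] [] []; simpl; rewrite ?comp_idl, ?comp_idr; reflexivity.
Defined.

Lemma pullback_exists : finitely_complete C -> exists P : Pullback f g, True.
Proof.
intros FC.
destruct (FC _ cospan_finite cospan_functor) as [L [pi [cone univ]]].
assert (HP : is_pullback f g (pi cospan_l) (pi cospan_r)).
{ split.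
  - exact (eq_trans (cone cospan_l cospan_m tt)
             (eq_sym (cone cospan_r cospan_m tt))).
  - intros Z u v E.
    pose (s := fun j : cospan_ob =>
      match j as j return Z ~> cospan_fob j with
      | cospan_l => u | cospan_r => v | cospan_m => f ∘ u end).
    assert (Hs : is_cone (D := cospan_functor) s).
    { intros [] [] []; simpl; rewrite ?comp_idl; auto. }
    destruct (univ Z s Hs) as [w [Hw Uw]]; exists w; split.
    + exact (conj (Hw cospan_l) (Hw cospan_r)).
    + intros w' [E1 E2]; apply Uw; intros []; simpl; auto.
      rewrite <- E1, comp_assoc; f_equal.
      exact (eq_sym (cone cospan_l cospan_m tt)). }
exists (Build_Pullback HP); exact I.
Qed.

Definition chosen_pullback (FC : finitely_complete C) : Pullback f g :=
  proj1_sig (constructive_indefinite_description _ (pullback_exists FC)).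

End CospanDiagram.

Section Points.
Variables (C : Category) (X : C).

Record Point : Type := {
  pt_ob :> C;
  pt_epi : pt_ob ~> X;
  pt_sec : X ~> pt_ob;
  pt_split : pt_epi ∘ pt_sec = idm X
}.

Record PointHom (P Q : Point) : Type := {
  pt_hom :> P ~> Q;
  pt_hom_epi : pt_epi Q ∘ pt_hom = pt_epi P;
  pt_hom_sec : pt_hom ∘ pt_sec P = pt_sec Q
}.

Lemma PointHom_ext (P Q : Point) (u v : PointHom P Q) :
  (u : P ~> Q) = v -> u = v.
Proof.
destruct u as [u u1 u2], v as [v v1 v2]; simpl; intros ->.
f_equal; apply proof_irrelevance.
Qed.

Definition PointHom_id (P : Point) : PointHom P P :=
  Build_PointHom (comp_idr (pt_epi P)) (comp_idl (pt_sec P)).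

Definition PointHom_comp (P Q R : Point) (v : PointHom Q R) (u : PointHom P Q) :
  PointHom P R.
Proof.
refine (@Build_PointHom P R ((v : Q ~> R) ∘ u) _ _).
- now rewrite comp_assoc, !pt_hom_epi.
- now rewrite <- comp_assoc, !pt_hom_sec.
Defined.

(* The category Pt_X(C) of split epimorphisms over X with chosen section. *)
Definition PointCategory : Category.
Proof.
refine {| ob := Point; hom := PointHom; idm := PointHom_id;
          comp := PointHom_comp |}.
- intros; apply PointHom_ext, comp_idl.
- intros; apply PointHom_ext, comp_idr.
- intros; apply PointHom_ext, comp_assoc.
Defined.

End Points.

Section PullbackFunctor.
Variables (C : Category) (FC : finitely_complete C) (Y X : C) (v : Y ~> X).

Lemma pullback_point_eq (P : Point X) :
  pt_epi P ∘ (pt_sec P ∘ v) = v ∘ idm Y.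
Proof. now rewrite comp_assoc, pt_split, comp_idl, comp_idr. Qed.

Definition pullback_point (P : Point X) : Point Y :=
  let R := chosen_pullback (pt_epi P) v FC in
  {| pt_ob := R;
     pt_epi := pb_snd R;
     pt_sec := pullback_map R (pullback_point_eq P);
     pt_split := pullback_map_snd R (pullback_point_eq P) |}.

Lemma pullback_point_hom_eq (P Q : Point X) (u : PointHom P Q) :
  let R := chosen_pullback (pt_epi P) v FC in
  pt_epi Q ∘ ((u : P ~> Q) ∘ pb_fst R) = v ∘ pb_snd R.
Proof.
intros R; rewrite comp_assoc, pt_hom_epi; exact (proj1 (pb_is_pullback R)).
Qed.

Definition pullback_point_hom (P Q : Point X) (u : PointHom P Q) :
  PointHom (pullback_point P) (pullback_point Q).
Proof.
refine (@Build_PointHom C Y (pullback_point P) (pullback_point Q)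
  (pullback_map (chosen_pullback (pt_epi Q) v FC) (pullback_point_hom_eq u))
  _ _).
- apply pullback_map_snd.
- apply pullback_hom_ext; simpl.
  + now rewrite comp_assoc, !pullback_map_fst, <- comp_assoc, pullback_map_fst,
      comp_assoc, pt_hom_sec.
  + now rewrite comp_assoc, !pullback_map_snd.
Defined.

Definition pullback_functor : Functor (PointCategory X) (PointCategory Y).
Proof.
refine {| fob := pullback_point : PointCategory X -> PointCategory Y;
          fmap := pullback_point_hom |}.
- intros P; apply PointHom_ext, pullback_hom_ext; simpl.
  + now rewrite pullback_map_fst, comp_idl, comp_idr.
  + now rewrite pullback_map_snd, comp_idr.
- intros P Q R u' u; apply PointHom_ext, pullback_hom_ext; simpl.
  + now rewrite (comp_assoc (pb_fst _)), !pullback_map_fst, <- !comp_assoc,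
      pullback_map_fst.
  + now rewrite (comp_assoc (pb_snd _)), !pullback_map_snd.
Defined.

End PullbackFunctor.

Definition conservative (A B : Category) (F : Functor A B) : Prop :=
  forall (P Q : A) (u : P ~> Q), is_iso (fmap F u) -> is_iso u.

Definition protomodular (C : Category) (FC : finitely_complete C) : Prop :=
  forall (Y X : C) (v : Y ~> X), conservative (pullback_functor FC v).

Definition propointed (C : Category) : Prop :=
  finitely_complete C /\
  exists (O : InitialObject C) (T : TerminalObject C),
    is_universal_extremal_epi (init_map O T).

Definition regular (C : Category) : Prop :=
  finitely_complete C /\
  (forall (X Y R : C) (f : X ~> Y) (r1 r2 : R ~> X),
        is_pullback f f r1 r2 ->
        exists (Q : C) (q : X ~> Q), is_coequalizer r1 r2 q) /\
  (forall (A B Y P : C) (q : A ~> B) (v : Y ~> B) (a : P ~> A) (q' : P ~> Y),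
        is_pullback q v a q' -> is_regular_epi q -> is_regular_epi q').

Definition prohomological (C : Category) : Prop :=
  propointed C /\ regular C /\
  exists FC : finitely_complete C, protomodular FC.

Section NormalSpans.
Variables (C : Category) (O : InitialObject C).

Definition is_kernel (X Y H : C) (f : X ~> Y) (e : H ~> O) (h : H ~> X) : Prop :=
  is_pullback f (init_map O Y) h e.

Definition is_normal_span (X H : C) (e : H ~> O) (h : H ~> X) : Prop :=
  exists (Y : C) (f : X ~> Y), is_kernel f e h.

Record NormalSpan (X : C) : Type := {
  ns_ob :> C;
  ns_zero : ns_ob ~> O;
  ns_map : ns_ob ~> X;
  ns_normal : is_normal_span ns_zero ns_map
}.

Record NormalSpanHom (X : C) (H H' : NormalSpan X) : Type := {
  ns_hom :> H ~> H';
  ns_hom_zero : ns_zero H' ∘ ns_hom = ns_zero H;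
  ns_hom_map : ns_map H' ∘ ns_hom = ns_map H
}.

Definition Quotient (X : C) (H : NormalSpan X) : Type :=
  Pushout (ns_zero H) (ns_map H).

Section Induced.
Variables (X : C) (H H' : NormalSpan X) (eta : NormalSpanHom H H').
(* K plays the role of H'/H, formed as the pushout of e along eta. *)
Variable K : Pushout (ns_zero H) eta.

Lemma quotient_zero_eq : idm O ∘ ns_zero H = ns_zero H' ∘ eta.
Proof. now rewrite comp_idl, ns_hom_zero. Qed.

Definition quotient_zero : K ~> O := pushout_map K quotient_zero_eq.

Variable XH : Quotient H.

Lemma quotient_map_eq :
  init_map O XH ∘ ns_zero H = po_inr XH ∘ ns_map H' ∘ eta.
Proof.
rewrite <- comp_assoc, ns_hom_map, <- (init_unique (po_inl XH)).
exact (proj1 (po_is_pushout XH)).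
Qed.

Definition quotient_map : K ~> XH := pushout_map K quotient_map_eq.

End Induced.
End NormalSpans.

(* Main.v *)
Require Import Defs.

(** By protomodularity, the kernel pair [R] of a morphism [f] with kernel
    [(H, e, h)] is generated by its diagonal together with the pullback of its
    first projection along [0 -> X], and that pullback maps to [H].  So a
    morphism [v] out of [X] coequalizes [R] iff [v ∘ h] factors through [e]:
    quotients by [H] are the coequalizers of [R], hence exist and are regular
    epimorphisms.  If [L] is the kernel of [X/H -> X/H'], then [H' -> L] is a
    pullback of [X -> X/H], hence a regular epimorphism, with kernel [H]; so
    [L] is [H'/H].  That [X/H'] is the quotient of [X/H] by [L] then follows
    from the universal properties. *)

Set Implicit Arguments.
Unset Strict Implicit.
Unset Printing Implicit Defensive.

(** * Pullbacks, pushouts and equalizers *)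

Section PullbacksPushouts.
Variable C : Category.

Lemma init_hom_unique (O : InitialObject C) (X : C) (f g : O ~> X) : f = g.
Proof. now rewrite (init_unique f), (init_unique g). Qed.

Lemma is_pullback_hom_ext (A B D P : C) (f : A ~> D) (g : B ~> D)
    (p : P ~> A) (q : P ~> B) (Z : C) (w w' : Z ~> P) :
  is_pullback f g p q -> p ∘ w = p ∘ w' -> q ∘ w = q ∘ w' -> w = w'.
Proof.
intros HP; exact (pullback_hom_ext (P := Build_Pullback HP) (w := w) (w' := w')).
Qed.

Lemma is_pullback_sym (A B D P : C) (f : A ~> D) (g : B ~> D)
    (p : P ~> A) (q : P ~> B) :
  is_pullback f g p q -> is_pullback g f q p.
Proof.
intros [E U]; split; [now symmetry|]; intros Z u v Euv.
destruct (U Z v u (eq_sym Euv)) as [w [[E1 E2] Uw]].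
exists w; split; [now split|].
intros w' [E1' E2']; apply Uw; now split.
Qed.

(** Cancellation half of the pasting law. It later exhibits [H' -> L] as a base change of [X -> X/H]
    and computes its kernel. *)
Lemma is_pullback_cancel (A B B' D P W : C) (f : A ~> D) (g : B ~> D)
    (k : B' ~> B) (p : P ~> A) (q : P ~> B) (x : W ~> A) (y : W ~> B')
    (t : W ~> P) :
  is_pullback f g p q -> is_pullback f (g ∘ k) x y ->
  p ∘ t = x -> q ∘ t = k ∘ y -> is_pullback q k t y.
Proof.
intros HP HW Ex Ey; split; [exact Ey|]; intros Z u v Euv.
assert (E : f ∘ (p ∘ u) = g ∘ k ∘ v).
{ now rewrite comp_assoc, (proj1 HP), <- comp_assoc, Euv, comp_assoc. }
destruct (proj2 HW Z _ _ E) as [w [[E1 E2] Uw]]; exists w; split.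
- split; [|exact E2].
  apply (is_pullback_hom_ext HP).
  + now rewrite comp_assoc, Ex.
  + now rewrite comp_assoc, Ey, <- comp_assoc, E2.
- intros w' [E1' E2']; apply Uw; split; [|exact E2'].
  now rewrite <- Ex, <- comp_assoc, E1'.
Qed.

Lemma is_pullback_iso (A B D P P' : C) (f : A ~> D) (g : B ~> D)
    (p : P ~> A) (q : P ~> B) (a : P' ~> P) :
  is_pullback f g p q -> is_iso a -> is_pullback f g (p ∘ a) (q ∘ a).
Proof.
intros [E U] [b [Eba Eab]]; split; [now rewrite !comp_assoc, E|].
intros Z u v Euv; destruct (U Z u v Euv) as [w [[E1 E2] Uw]].
exists (b ∘ w); split.
- now rewrite <- !comp_assoc, !(comp_assoc a), Eab, comp_idl.
- intros w' [E1' E2'].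
  rewrite (Uw (a ∘ w')) by now rewrite !comp_assoc.
  now rewrite comp_assoc, Eba, comp_idl.
Qed.

Lemma is_pushout_hom_ext (A B D Q : C) (f : D ~> A) (g : D ~> B)
    (i : A ~> Q) (j : B ~> Q) (Z : C) (w w' : Q ~> Z) :
  is_pushout f g i j -> w ∘ i = w' ∘ i -> w ∘ j = w' ∘ j -> w = w'.
Proof.
intros [E U] Ei Ej.
assert (E' : w' ∘ i ∘ f = w' ∘ j ∘ g) by now rewrite <- !comp_assoc, E.
destruct (U _ _ _ E') as [x [_ Ux]].
now rewrite <- (Ux w (conj Ei Ej)), <- (Ux w' (conj eq_refl eq_refl)).
Qed.

Lemma is_pushout_unique (A B D Q Q' : C) (f : D ~> A) (g : D ~> B)
    (i : A ~> Q) (j : B ~> Q) (i' : A ~> Q') (j' : B ~> Q') :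
  is_pushout f g i j -> is_pushout f g i' j' ->
  exists a : Q ~> Q', is_iso a /\ a ∘ i = i' /\ a ∘ j = j'.
Proof.
intros HQ HQ'.
destruct (proj2 HQ _ _ _ (proj1 HQ')) as [a [[Ei Ej] _]].
destruct (proj2 HQ' _ _ _ (proj1 HQ)) as [b [[Ei' Ej'] _]].
exists a; split; [|now split]; exists b; split.
- apply (is_pushout_hom_ext HQ); rewrite <- comp_assoc, comp_idl; congruence.
- apply (is_pushout_hom_ext HQ'); rewrite <- comp_assoc, comp_idl; congruence.
Qed.

(** Maps out of [Q] always agree on the leg from the initial object, so [j] alone separates them. *)
Lemma is_pushout_init_epi (O : InitialObject C) (B D Q : C) (f : D ~> O)
    (g : D ~> B) (i : O ~> Q) (j : B ~> Q) :
  is_pushout f g i j -> is_epi j.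
Proof.
intros HQ Z u v; apply (is_pushout_hom_ext HQ), init_hom_unique.
Qed.

Lemma product_exists (FC : finitely_complete C) (T : TerminalObject C)
    (A B : C) :
  exists (P : C) (p : P ~> A) (q : P ~> B),
    (forall (Z : C) (u : Z ~> A) (v : Z ~> B),
        exists w : Z ~> P, p ∘ w = u /\ q ∘ w = v) /\
    (forall (Z : C) (w w' : Z ~> P),
        p ∘ w = p ∘ w' -> q ∘ w = q ∘ w' -> w = w').
Proof.
destruct (pullback_exists (term_map T A) (term_map T B) FC) as [P _].
exists P, (pb_fst P), (pb_snd P); split.
- intros Z u v.
  assert (E : term_map T A ∘ u = term_map T B ∘ v).
  { now rewrite (term_unique (term_map T A ∘ u)), term_unique. }
  exists (pullback_map P E).
  split; [apply pullback_map_fst | apply pullback_map_snd].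
- intros Z w w'; apply pullback_hom_ext.
Qed.

(** The equalizer is the pullback of the graphs [(id, f)] and [(id, g)] into the product; their
    common first component forces the two projections of this pullback to coincide. *)
Lemma equalizer_exists (FC : finitely_complete C) (T : TerminalObject C)
    (A B : C) (f g : A ~> B) :
  exists (M : C) (m : M ~> A), is_mono m /\ f ∘ m = g ∘ m /\
    forall (Z : C) (z : Z ~> A), f ∘ z = g ∘ z -> exists w, m ∘ w = z.
Proof.
destruct (product_exists FC T A B) as [P [p [q [pair ext]]]].
destruct (pair A (idm A) f) as [u [Epu Equ]].
destruct (pair A (idm A) g) as [v [Epv Eqv]].
destruct (pullback_exists u v FC) as [M _].
pose proof (proj1 (pb_is_pullback M)) as E.
assert (E12 : pb_fst M = pb_snd M).
{ pose proof (f_equal (comp p) E) as E'.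
  now rewrite !comp_assoc, Epu, Epv, !comp_idl in E'. }
exists M, (pb_fst M); split; [|split].
- intros Z w w' Ew; apply pullback_hom_ext; [exact Ew | now rewrite <- E12].
- now rewrite <- Equ, <- comp_assoc, E, comp_assoc, Eqv, E12.
- intros Z z Ez.
  assert (Ez' : u ∘ z = v ∘ z).
  { apply ext; rewrite !comp_assoc; [now rewrite Epu, Epv|].
    now rewrite Equ, Eqv. }
  exists (pullback_map M Ez'); apply pullback_map_fst.
Qed.

End PullbacksPushouts.

(** * Kernels, kernel pairs and quotients under protomodularity *)

Section Protomodular.
Variables (C : Category) (FC : finitely_complete C) (T : TerminalObject C).
Hypothesis PM : protomodular FC.
Variable O : InitialObject C.

(** The section [s] makes [m] a morphism of points over [X]. Its pullback along [0 -> X] is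
    invertible, because the whole pullback of [P] lifts through [m], and conservativity reflects
    this back to [m]. *)
Lemma protomodular_mono_iso (X : C) (P : Point X) (M : C) (m : M ~> P)
    (s : X ~> M) :
  is_mono m -> m ∘ s = pt_sec P ->
  (forall (N : C) (k : N ~> P) (z : N ~> O),
      pt_epi P ∘ k = init_map O X ∘ z -> exists j, m ∘ j = k) ->
  is_iso m.
Proof.
intros Hm Es Hk.
assert (Hsplit : pt_epi P ∘ m ∘ s = idm X).
{ now rewrite <- comp_assoc, Es, pt_split. }
pose (Q := Build_Point Hsplit).
pose (mh := @Build_PointHom C X Q P m eq_refl Es).
pose (v := init_map O X).
pose (RP := chosen_pullback (pt_epi P) v FC).
pose (RQ := chosen_pullback (pt_epi Q) v FC).
(* The universal choice of [k] is the pullback of [P] itself; its lift [j] induces the inverse over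
   [0]. *)
destruct (Hk RP (pb_fst RP) (pb_snd RP) (proj1 (pb_is_pullback RP)))
  as [j Ej].
assert (E : pt_epi Q ∘ j = v ∘ pb_snd RP).
{ simpl; rewrite <- comp_assoc, Ej; exact (proj1 (pb_is_pullback RP)). }
assert (Hn : is_iso (fmap (pullback_functor FC v) mh)).
{ unshelve eexists.
  - refine (@Build_PointHom C O (pullback_point FC v P) (pullback_point FC v Q)
      (pullback_map RQ E) _ _).
    + apply pullback_map_snd.
    + apply init_hom_unique.
  - split; apply PointHom_ext, pullback_hom_ext; subst RP RQ; simpl in *.
    + apply Hm.
      rewrite (comp_assoc (pb_fst _)), pullback_map_fst, comp_idr.
      rewrite comp_assoc, Ej.
      apply pullback_map_fst.
    + now rewrite comp_assoc, !pullback_map_snd, comp_idr.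
    + now rewrite comp_assoc, !pullback_map_fst, <- comp_assoc,
        pullback_map_fst, comp_idr.
    + now rewrite comp_assoc, !pullback_map_snd, comp_idr. }
destruct (PM Hn) as [n [E1 E2]].
exists (pt_hom n); split.
- exact (f_equal (@pt_hom _ _ _ _) E1).
- exact (f_equal (@pt_hom _ _ _ _) E2).
Qed.

(** On the kernel pair of [f], the equalizer of the two composites with [v] contains the diagonal
    and the pullback of the first projection along [0 -> X], so [protomodular_mono_iso] makes it
    everything. *)
Lemma kernel_annihilates_kernel_pair (X Y H : C) (f : X ~> Y) (e : H ~> O)
    (h : H ~> X) (Z : C) (v : X ~> Z) (A : C) (a b : A ~> X) :
  is_kernel f e h -> v ∘ h = init_map O Z ∘ e -> f ∘ a = f ∘ b ->
  v ∘ a = v ∘ b.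
Proof.
intros HK Ev Eab.
destruct (pullback_exists f f FC) as [R _].
pose proof (proj1 (pb_is_pullback R)) as ER.
(* The kernel pair as a point over [X]: the first projection, split by the diagonal. *)
pose (P := Build_Point (pullback_map_fst R (eq_refl (f ∘ idm X)))).
destruct (equalizer_exists FC T (v ∘ pb_fst R) (v ∘ pb_snd R))
  as [M [m [Hm [Em Um]]]].
destruct (Um X (pt_sec P)) as [s Es].
{ simpl; now rewrite <- !comp_assoc, pullback_map_fst, pullback_map_snd. }
assert (Hiso : is_iso m).
{ apply (@protomodular_mono_iso X P M m s Hm Es).
  intros N k z Ek; apply Um; simpl in Ek.
  (* Over [0] the second component lands in the kernel, so [v] sends both components to the
     composite of [z] with [0 -> Z]. *)
  assert (E2 : f ∘ (pb_snd R ∘ k) = init_map O Y ∘ z).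
  { rewrite comp_assoc, <- ER, <- comp_assoc, Ek, comp_assoc.
    f_equal; apply init_hom_unique. }
  destruct (proj2 HK N _ _ E2) as [w [[E3 E4] _]].
  rewrite <- !comp_assoc, Ek, <- E3, (comp_assoc v h), Ev, <- comp_assoc, E4.
  rewrite comp_assoc; f_equal; apply init_hom_unique. }
destruct Hiso as [n [_ En]].
assert (E : v ∘ pb_fst R = v ∘ pb_snd R).
{ now rewrite <- (comp_idr (v ∘ pb_fst R)), <- En, comp_assoc, Em,
    <- comp_assoc, En, comp_idr. }
pose proof (f_equal (fun x => x ∘ pullback_map R Eab) E) as E'; simpl in E'.
now rewrite <- !comp_assoc, pullback_map_fst, pullback_map_snd in E'.
Qed.

(** The pair formed by [h] and the composite [H -> 0 -> X] lies in the kernel pair. *)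
Lemma kernel_pair_annihilates_kernel (X Y H R : C) (f : X ~> Y) (e : H ~> O)
    (h : H ~> X) (r1 r2 : R ~> X) (Z : C) (v : X ~> Z) :
  is_kernel f e h -> is_pullback f f r1 r2 -> v ∘ r1 = v ∘ r2 ->
  v ∘ h = init_map O Z ∘ e.
Proof.
intros HK HR Ev.
assert (E : f ∘ h = f ∘ (init_map O X ∘ e)).
{ rewrite (proj1 HK), comp_assoc; f_equal; apply init_hom_unique. }
destruct (proj2 HR _ _ _ E) as [w [[E1 E2] _]].
rewrite <- E1, comp_assoc, Ev, <- comp_assoc, E2, comp_assoc.
f_equal; apply init_hom_unique.
Qed.

(** [q] is the coequalizer of some pair that it identifies, and any [v] with [v ∘ h] factoring
    through [e] identifies that pair too, by [kernel_annihilates_kernel_pair]. *)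
Lemma regular_epi_pushout (X Q H : C) (q : X ~> Q) (e : H ~> O) (h : H ~> X) :
  is_regular_epi q -> is_kernel q e h -> is_pushout e h (init_map O Q) q.
Proof.
intros [A [a [b Hq]]] HK; split; [symmetry; exact (proj1 HK)|].
intros Z u v Euv; rewrite (init_unique u) in *.
destruct (proj2 Hq Z v) as [w [Ew Uw]].
{ exact (kernel_annihilates_kernel_pair HK (eq_sym Euv) (proj1 Hq)). }
exists w; split; [split; [apply init_hom_unique | exact Ew]|].
intros w' [_ Ew']; exact (Uw w' Ew').
Qed.

Lemma quotient_exists (RC : regular C) (X H : C) (e : H ~> O) (h : H ~> X) :
  is_normal_span e h -> inhabited (Pushout e h).
Proof.
intros [Y [f HK]].
destruct (pullback_exists f f FC) as [R _].
pose proof (pb_is_pullback R) as HR.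
destruct (proj1 (proj2 RC) _ _ _ _ _ _ HR) as [Q [q Hq]].
assert (HQ : is_kernel q e h).
(* As [f] factors through [q], whatever [q] annihilates is annihilated by [f] and lifts to [H]. *)
{ destruct (proj2 Hq _ f (proj1 HR)) as [m [Em _]].
  split; [exact (kernel_pair_annihilates_kernel HK HR (proj1 Hq))|].
  intros Z u v Euv; apply (proj2 HK).
  rewrite <- Em, <- comp_assoc, Euv, comp_assoc.
  f_equal; apply init_hom_unique. }
constructor; eapply Build_Pushout, regular_epi_pushout; [|exact HQ].
now exists R, (pb_fst R), (pb_snd R).
Qed.

(** The two annihilation lemmas identify [q] as the coequalizer of the kernel pair of [f]. *)
Lemma quotient_regular_epi (X H Q : C) (e : H ~> O) (h : H ~> X)
    (i : O ~> Q) (q : X ~> Q) :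
  is_normal_span e h -> is_pushout e h i q -> is_regular_epi q.
Proof.
intros [Y [f HK]] HQ; rewrite (init_unique i) in HQ.
destruct (pullback_exists f f FC) as [R _].
pose proof (pb_is_pullback R) as HR.
exists R, (pb_fst R), (pb_snd R); split.
- exact (kernel_annihilates_kernel_pair HK (eq_sym (proj1 HQ)) (proj1 HR)).
- intros Z u Eu.
  pose proof (kernel_pair_annihilates_kernel HK HR Eu) as Eh.
  destruct (proj2 HQ _ _ _ (eq_sym Eh)) as [w [[_ Ew] _]].
  exists w; split; [exact Ew|]; intros w' Ew'.
  apply (is_pushout_init_epi HQ); congruence.
Qed.

End Protomodular.

(** * Kernels of quotient maps and restriction of normal spans *)

Section Kernels.
Variables (C : Category) (O : InitialObject C).

(** A morphism [f] with kernel [H] factors through the pushout, so the kernel of [q] cannot exceed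
    that of [f]. *)
Lemma quotient_kernel (X H Q : C) (e : H ~> O) (h : H ~> X)
    (i : O ~> Q) (q : X ~> Q) :
  is_normal_span e h -> is_pushout e h i q -> is_kernel q e h.
Proof.
intros [Y [f HK]] HQ; rewrite (init_unique i) in HQ.
destruct (proj2 HQ _ _ _ (eq_sym (proj1 HK))) as [m [[Ei Em] _]].
split; [exact (eq_sym (proj1 HQ))|]; intros Z u v Euv; apply (proj2 HK).
now rewrite <- Em, <- comp_assoc, Euv, comp_assoc, Ei.
Qed.

(* [h'] need not be monic, since there may be several morphisms into [0];
   only [h'] and [e'] are jointly monic.  So the kernel of [f ∘ h'] can be
   larger than [H], while that of [(f ∘ h', e')] is [H]. *)
Lemma normal_span_restrict (FC : finitely_complete C) (T : TerminalObject C)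
    (X : C) (H H' : NormalSpan O X) (eta : NormalSpanHom H H') :
  is_normal_span (ns_zero H) eta.
Proof.
destruct (ns_normal H) as [Y [f HK]], (ns_normal H') as [Y' [f' HK']].
destruct (product_exists FC T Y O) as [P [p [q [pair ext]]]].
destruct (pair H' (f ∘ ns_map H') (ns_zero H')) as [k [Ep Eq]].
assert (Epi : p ∘ init_map O P = init_map O Y) by apply init_hom_unique.
assert (Eqi : q ∘ init_map O P = idm O) by apply init_hom_unique.
exists P, k; split.
- apply ext; rewrite !comp_assoc.
  + rewrite Ep, Epi, <- comp_assoc, ns_hom_map; exact (proj1 HK).
  + now rewrite Eq, Eqi, comp_idl, ns_hom_zero.
- intros Z u v Euv.
  assert (E1 : f ∘ (ns_map H' ∘ u) = init_map O Y ∘ v).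
  { now rewrite comp_assoc, <- Ep, <- comp_assoc, Euv, comp_assoc, Epi. }
  assert (E2 : ns_zero H' ∘ u = v).
  { now rewrite <- Eq, <- comp_assoc, Euv, comp_assoc, Eqi, comp_idl. }
  destruct (proj2 HK Z _ _ E1) as [w [[Ew1 Ew2] Uw]]; exists w; split.
  + split; [|exact Ew2].
    apply (is_pullback_hom_ext HK'); rewrite comp_assoc.
    * now rewrite ns_hom_map.
    * now rewrite ns_hom_zero, E2.
  + intros w' [Ew1' Ew2']; apply Uw; split; [|exact Ew2'].
    now rewrite <- (ns_hom_map eta), <- comp_assoc, Ew1'.
Qed.

End Kernels.

(** * Comparison of [X/H] with [X/H'] *)

Section Noether.
Variables (C : Category) (FC : finitely_complete C) (T : TerminalObject C).
Hypotheses (PM : protomodular FC) (RC : regular C).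
Variables (O : InitialObject C) (X : C) (H H' : NormalSpan O X).
Variables (eta : NormalSpanHom H H') (XH : Quotient H) (XH' : Quotient H').
Variable K : Pushout (ns_zero H) eta.

Lemma quotient_map_inr : quotient_map K XH ∘ po_inr K = po_inr XH ∘ ns_map H'.
Proof. apply pushout_map_inr. Qed.

Lemma quotient_zero_inr : quotient_zero K ∘ po_inr K = ns_zero H'.
Proof. apply pushout_map_inr. Qed.

Lemma quotient_factor : exists phi : XH ~> XH', phi ∘ po_inr XH = po_inr XH'.
Proof.
assert (E : po_inl XH' ∘ ns_zero H = po_inr XH' ∘ ns_map H).
{ rewrite <- (ns_hom_zero eta), <- (ns_hom_map eta), !comp_assoc.
  now rewrite (proj1 (po_is_pushout XH')). }
exists (pushout_map XH E); apply pushout_map_inr.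
Qed.

Variable phi : XH ~> XH'.
Hypothesis Ephi : phi ∘ po_inr XH = po_inr XH'.

Lemma quotient_factor_kernel :
  is_kernel phi (quotient_zero K) (quotient_map K XH).
Proof.
destruct (pullback_exists phi (init_map O XH') FC) as [L _].
pose proof (pb_is_pullback L) as HL.
pose proof (quotient_kernel (ns_normal H) (po_is_pushout XH)) as HK.
pose proof (quotient_kernel (ns_normal H') (po_is_pushout XH')) as HK'.
assert (E : phi ∘ (po_inr XH ∘ ns_map H') = init_map O XH' ∘ ns_zero H').
{ rewrite comp_assoc, Ephi; exact (proj1 HK'). }
destruct (pullback_map_sig L E) as [r [Er1 Er2]].
(* [L] and [H'] are the kernels of [phi] and of [phi ∘ po_inr XH], so cancellation applies. *)
assert (Hr : is_pullback (po_inr XH) (pb_fst L) (ns_map H') r).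
{ rewrite <- Ephi in HK'.
  apply is_pullback_sym.
  exact (is_pullback_cancel (is_pullback_sym HL) (is_pullback_sym HK')
    Er2 Er1). }
assert (Hreg : is_regular_epi r).
{ apply (proj2 (proj2 RC) _ _ _ _ _ _ _ _ Hr).
  exact (quotient_regular_epi T PM (ns_normal H) (po_is_pushout XH)). }
(* The map [0 -> XH] factors through [pb_fst L], so cancellation reads off the kernel of [r] from
   that of [po_inr XH]. *)
assert (Hker : is_kernel r (ns_zero H) eta).
{ apply (is_pullback_cancel (k := init_map O L) (x := ns_map H) Hr).
  - replace (pb_fst L ∘ init_map O L) with (init_map O XH)
      by apply init_hom_unique; exact HK.
  - apply ns_hom_map.
  - apply (is_pullback_hom_ext HL); rewrite !comp_assoc.
    + rewrite Er1, <- comp_assoc, ns_hom_map, (proj1 HK).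
      f_equal; apply init_hom_unique.
    + rewrite Er2, ns_hom_zero, <- (comp_idl (ns_zero H)) at 1.
      f_equal; apply init_hom_unique. }
pose proof (regular_epi_pushout T PM Hreg Hker) as HP.
(* [K] and [L] are pushouts of the same span. The comparison [a] matches the induced maps out of [K]
   with the projections of [L], as is checked on the epimorphism [po_inr K]. *)
destruct (is_pushout_unique (po_is_pushout K) HP) as [a [Ha [_ Ea]]].
pose proof (is_pushout_init_epi (po_is_pushout K)) as Hepi.
replace (quotient_map K XH) with (pb_fst L ∘ a).
2: { apply Hepi; rewrite <- comp_assoc, Ea, quotient_map_inr; exact Er1. }
replace (quotient_zero K) with (pb_snd L ∘ a).
2: { apply Hepi; rewrite <- comp_assoc, Ea, quotient_zero_inr; exact Er2. }
exact (is_pullback_iso HL Ha).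
Qed.

Lemma quotient_factor_pushout :
  is_pushout (quotient_zero K) (quotient_map K XH) (init_map O XH') phi.
Proof.
split; [symmetry; exact (proj1 quotient_factor_kernel)|].
intros Z u v Euv.
(* Precomposing with [po_inr K] turns the cocone over [K] into one over [H'], to which the universal
   property of [XH'] applies. *)
assert (E : u ∘ ns_zero H' = v ∘ po_inr XH ∘ ns_map H').
{ now rewrite <- quotient_zero_inr, <- comp_assoc, <- quotient_map_inr,
    !comp_assoc, Euv. }
destruct (proj2 (po_is_pushout XH') _ _ _ E) as [w [[_ Ew] _]].
assert (Ewphi : w ∘ phi = v).
{ apply (is_pushout_init_epi (po_is_pushout XH)).
  now rewrite <- comp_assoc, Ephi. }
exists w; split; [split; [apply init_hom_unique | exact Ewphi]|].
intros w' [_ Ew']; apply (is_pushout_init_epi (po_is_pushout XH')).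
now rewrite <- Ephi, !comp_assoc, Ewphi, Ew'.
Qed.

End Noether.

Theorem theorem5p17 (C : Category) (hC : prohomological C)
    (O : InitialObject C) (X : C) (H H' : NormalSpan O X)
    (eta : NormalSpanHom H H') :
  is_normal_span (ns_zero H) eta /\
  inhabited (Quotient H) /\
  inhabited (Quotient H') /\
  inhabited (Pushout (ns_zero H) eta) /\
  forall (XH : Quotient H) (XH' : Quotient H') (K : Pushout (ns_zero H) eta),
    is_normal_span (quotient_zero K) (quotient_map K XH) /\
    inhabited (Pushout (quotient_zero K) (quotient_map K XH)) /\
    forall R : Pushout (quotient_zero K) (quotient_map K XH),
      isomorphic R XH'.
Proof.
destruct hC as [[_ [_ [T _]]] [RC [FC PM]]].
pose proof (normal_span_restrict FC T eta) as HN.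
pose proof (@quotient_exists C FC T PM O RC) as QE.
split; [exact HN|].
split; [exact (QE _ _ _ _ (ns_normal H))|].
split; [exact (QE _ _ _ _ (ns_normal H'))|].
split; [exact (QE _ _ _ _ HN)|].
intros XH XH' K.
destruct (quotient_factor eta XH XH') as [phi Ephi].
pose proof (quotient_factor_pushout T PM RC K Ephi) as HP.
split; [|split].
- exists XH', phi; exact (quotient_factor_kernel T PM RC K Ephi).
- exact (inhabits (Build_Pushout HP)).
- intros R.
  (* [XH'] is itself a pushout of this span, so every other choice [R] is isomorphic to it. *)
  destruct (is_pushout_unique (po_is_pushout R) HP) as [a [Ha _]].
  now exists a.
Qed.
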